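(* Let $K$ be a number field with ring of integers $A$, $p$ a prime number, $\mathcal{P}_1,\dots,\mathcal{P}_s$ distinct prime ideals of $A$ lying over $p\mathbb{Z}$, $k_1,\dots,k_s$ positive integers, and $R=\prod_{i=1}^s A/\mathcal{P}_i^{k_i}$. Let $M$ be a maximal subring of $R$. Then $M$ has one of the following forms: (i) $M=A/\mathcal{P}_1^{k_1}\times\cdots\times A/\mathcal{P}_{i-1}^{k_{i-1}}\times M_i\times A/\mathcal{P}_{i+1}^{k_{i+1}}\times\cdots\times A/\mathcal{P}_s^{k_s}$ for some $i$, where $M_i$ is an ordinary maximal subring of $A/\mathcal{P}_i^{k_i}$ (ordinary type 1); (ii) $M=A/\mathcal{P}_1^{k_1}\times\cdots\times A/\mathcal{P}_{i-1}^{k_{i-1}}\times M_i\times A/\mathcal{P}_{i+1}^{k_{i+1}}\times\cdots\times A/\mathcal{P}_s^{k_s}$ for some $i$, where $M_i$ is an exceptional maximal subring of $A/\mathcal{P}_i^{k_i}$ (exceptional type 1); (iii) there are indices $1\le i<j\le s$ such that $\mathcal{P}_i$ and $\mathcal{P}_j$ have the same residual degree, and a ring isomorphism $\sigma: A/\mathcal{P}_i\to A/\mathcal{P}_j$, such that $$M=\{(a_1+\mathcal{P}_1^{k_1},\dots,a_s+\mathcal{P}_s^{k_s})\in R:\ a_j+\mathcal{P}_j=\sigma(a_i+\mathcal{P}_i)\}$$ (type 2).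
   Context: Convention: a subring of a ring $S$ is an additive subgroup closed under multiplication, not necessarily containing $1$; a maximal subring is a proper subring not strictly contained in any proper subring. For a subring $T$ of a commutative ring $S$, the conductor is $(S:T)=\{x\in S: xS\subseteq T\}$. For a prime ideal $\mathcal{P}$ of $A$ and $k\ge1$, a maximal subring $N$ of $A/\mathcal{P}^k$ is called ordinary if $(A/\mathcal{P}^k:N)=\mathcal{P}/\mathcal{P}^k$, and exceptional if $(A/\mathcal{P}^k:N)=\mathcal{P}^2/\mathcal{P}^k$. *)

(* Defs.v *)
From HB Require Import structures.
From mathcomp Require Import all_boot all_order all_algebra all_field.
From mathcomp Require Import boolp.

Set Implicit Arguments.
Unset Strict Implicit.
Unset Printing Implicit Defensive.

Import GRing.Theory.
Local Open Scope ring_scope.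
Local Open Scope quotient_scope.

Definition algebraic_integer (K : fieldExtType rat) : {pred K} :=
  fun x => `[< integralOver (intr : int -> K) x >].

Fact algebraic_integer_subring (K : fieldExtType rat) :
  subring_closed (@algebraic_integer K).
Proof.
split=> [|x y /asboolP hx /asboolP hy|x y /asboolP hx /asboolP hy].
- exact/asboolP/integral1.
- exact/asboolP/integral_sub.
- exact/asboolP/integral_mul.
Qed.

HB.instance Definition _ (K : fieldExtType rat) :=
  GRing.isSubringClosed.Build K (@algebraic_integer K)
    (@algebraic_integer_subring K).

Record ring_of_integers (K : fieldExtType rat) := RingOfIntegers {
  ri_val : K;
  _ : ri_val \in @algebraic_integer K }.

HB.instance Definition _ (K : fieldExtType rat) := [isSub for @ri_val K].
HB.instance Definition _ (K : fieldExtType rat) :=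
  [Choice of ring_of_integers K by <:].
HB.instance Definition _ (K : fieldExtType rat) :=
  [SubChoice_isSubComNzRing of ring_of_integers K by <:].

Section IdealPowers.
Variable R : comNzRingType.

Definition idealM (I J : {pred R}) : {pred R} := fun x =>
  `[< exists n (u v : 'I_n -> R),
        [/\ forall l, u l \in I, forall l, v l \in J
          & x = \sum_(l < n) u l * v l] >].

Definition idealX (I : {pred R}) (k : nat) : {pred R} :=
  iter k (idealM I) predT.

(* The library only forms ring quotients by proper ideals, so the structure
   of ideal is attached to I ^ k together with a proof of 0 < k. *)
Definition idealXp (I : idealr R) (k : nat) & (0 < k)%N : {pred R} :=
  idealX (I : {pred R}) k.

Fact idealXp_closed (I : idealr R) k (hk : (0 < k)%N) :
  idealr_closed (idealXp I hk).
Proof.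
have idX n : 0 \in idealX (I : {pred R}) n /\
    forall a, {in idealX (I : {pred R}) n &, forall u v,
      a * u + v \in idealX (I : {pred R}) n}.
  case: n => [//|n]; split.
    apply/asboolP; exists 0%N, (fun=> 0), (fun=> 0).
    by split=> [[]|[]|] //; rewrite big_ord0.
  move=> a x y /asboolP[n1 [u1 [v1 [Iu1 Jv1 ->]]]].
  move=> /asboolP[n2 [u2 [v2 [Iu2 Jv2 ->]]]]; apply/asboolP.
  exists (n1 + n2)%N.
  exists (fun l => match split l with inl i => a * u1 i | inr i => u2 i end).
  exists (fun l => match split l with inl i => v1 i | inr i => v2 i end).
  split=> [l|l|].
  - by case: (split l) => i //; apply: idealMr.
  - by case: (split l).
  rewrite big_split_ord /= mulr_sumr; congr (_ + _); apply: eq_bigr => i _.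
    by rewrite (unsplitK (inl i)) mulrA.
  by rewrite (unsplitK (inr i)).
split; [exact: (idX k).1 | | exact: (idX k).2].
case: k hk => // k hk; apply/negP => /asboolP[n [u [v [Iu _ e1]]]].
have : 1 \in (I : {pred R}).
  by rewrite e1; apply: rpred_sum => i _; rewrite mulrC idealMr.
by rewrite idealr1.
Qed.

HB.instance Definition _ (I : idealr R) k (hk : (0 < k)%N) :=
  isIdealr.Build R (idealXp I hk) (idealXp_closed I hk).

(* I / J as a subset of R / J; it is (I + J) / J when I does not contain J. *)
Definition ideal_image (I : {pred R}) (J : idealr R) : {pred {ideal_quot J}} :=
  fun a => `[< exists2 x, x \in I & a = \pi_{ideal_quot J} x >].

End IdealPowers.
Arguments ideal_image {R} I J.

Section RingProduct.
Variables (I : finType) (T : I -> comNzRingType).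

Definition ring_product := {dffun forall i, T i}.

HB.instance Definition _ := Choice.on ring_product.

Implicit Types a b c : ring_product.
Definition rp_zero : ring_product := [ffun i => 0 : T i].
Definition rp_one : ring_product := [ffun i => 1 : T i].
Definition rp_opp a : ring_product := [ffun i => - a i].
Definition rp_add a b : ring_product := [ffun i => a i + b i].
Definition rp_mul a b : ring_product := [ffun i => a i * b i].

Fact rp_addA : associative rp_add.
Proof. by move=> a b c; apply/ffunP=> i; rewrite !ffunE addrA. Qed.
Fact rp_addC : commutative rp_add.
Proof. by move=> a b; apply/ffunP=> i; rewrite !ffunE addrC. Qed.
Fact rp_add0 : left_id rp_zero rp_add.
Proof. by move=> a; apply/ffunP=> i; rewrite !ffunE add0r. Qed.
Fact rp_addN : left_inverse rp_zero rp_opp rp_add.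
Proof. by move=> a; apply/ffunP=> i; rewrite !ffunE addNr. Qed.
HB.instance Definition _ :=
  GRing.isZmodule.Build ring_product rp_addA rp_addC rp_add0 rp_addN.

Fact rp_mulA : associative rp_mul.
Proof. by move=> a b c; apply/ffunP=> i; rewrite !ffunE mulrA. Qed.
Fact rp_mulC : commutative rp_mul.
Proof. by move=> a b; apply/ffunP=> i; rewrite !ffunE mulrC. Qed.
Fact rp_mul1 : left_id rp_one rp_mul.
Proof. by move=> a; apply/ffunP=> i; rewrite !ffunE mul1r. Qed.
Fact rp_mulDl : left_distributive rp_mul rp_add.
Proof. by move=> a b c; apply/ffunP=> i; rewrite !ffunE mulrDl. Qed.
HB.instance Definition _ := GRing.Zmodule_isComPzRing.Build ring_product
  rp_mulA rp_mulC rp_mul1 rp_mulDl.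

End RingProduct.

Section Subrings.
Variable S : comPzRingType.
Implicit Types M N : {pred S}.

(* not the library's subring_closed, which demands 1 *)
Definition is_subring M := zmod_closed M /\ GRing.mulr_2closed M.

Definition proper_subring M := is_subring M /\ exists x, x \notin M.

Definition maximal_subring M :=
  proper_subring M /\
  forall N, proper_subring N -> {subset M <= N} -> N =i M.

Definition conductor M : {pred S} := fun x => `[< forall y, x * y \in M >].

End Subrings.

Section Primes.
Variable R : comNzRingType.

Definition ordinary (P : prime_idealr R) (k : nat) (hk : (0 < k)%N)
    (N : {pred {ideal_quot (idealXp P hk)}}) :=
  maximal_subring N /\ conductor N =i ideal_image P (idealXp P hk).

(* For k = 1 the image of P ^ 2 in R / P is 0, as is that of P, and the two
   notions agree. *)
Definition exceptional (P : prime_idealr R) (k : nat) (hk : (0 < k)%N)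
    (N : {pred {ideal_quot (idealXp P hk)}}) :=
  maximal_subring N /\ conductor N =i ideal_image (idealX P 2) (idealXp P hk).

Definition lies_over (P : prime_idealr R) (p : nat) :=
  forall z : int, (z%:~R \in (P : {pred R})) = (p%:Z %| z)%Z.

(* R / P has dimension f over 'F_p, i.e. a basis of f elements; the action of
   'F_p on R / P is multiplication by the image of any representative, which
   makes sense when P lies over p. *)
Definition residual_degree (P : prime_idealr R) (p f : nat) :=
  exists b : 'I_f -> {ideal_quot P}, forall x, exists! c : {ffun 'I_f -> 'F_p},
    x = \sum_(l < f) (c l : nat)%:R * b l.

End Primes.

(* Main.v *)
(* Write T_i = A / P_i ^ k_i.  Each T_i is a chain ring: its maximal ideal is
   generated by a nilpotent t_i.  For a maximal subring M of a commutative ring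
   S and a in S, M + a S is a subring, so either a S <= M or M + a S = S; all
   the case distinctions are instances of this.

   If M + e_i t_i R = R for some i, where e_i is the i-th idempotent, then
   1 - e_i is a power of an element of M, because t_i is nilpotent, and M is the
   preimage of a maximal subring of T_i.  The same holds if (1 - e_i) R <= M.
   Otherwise M projects onto every T_i and contains every e_i t_i R, hence is
   determined by its image in the product of the residue fields; if any two
   coordinates could be separated by M, then M = R, and a non-separated pair
   gives the graph of an isomorphism by Goursat's argument.

   In a chain ring with maximal ideal (t), either t T <= M and the conductor is
   (t), or M + t T = T; then M + t ^ 2 T = T is impossible by descending
   induction on the powers of t, and the conductor is (t ^ 2).

   That T_i is a chain ring amounts to P being locally principal.  Any
   dim K + 1 elements of K satisfy an integer relation with a coefficient prime
   to p; this makes P finitely generated modulo p A, yields b outside p A with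
   b P <= p A, and shows that g = b / p cannot satisfy g P <= P, as g would then
   be integral.  So g t = w is not in P for some t in P, and w P <= t A. *)
Require Import Defs.
From HB Require Import structures.
From mathcomp Require Import all_boot all_order all_algebra all_field.
From mathcomp Require Import boolp ring.

Set Implicit Arguments.
Unset Strict Implicit.
Unset Printing Implicit Defensive.

Import GRing.Theory.
Local Open Scope ring_scope.
Local Open Scope quotient_scope.

(** * Maximal subrings of a commutative ring *)

Section SubringTheory.
Variables (S : comPzRingType) (M : {pred S}).
Hypothesis M_sub : is_subring M.

Lemma subring0 : 0 \in M. Proof. by case: M_sub => [[]]. Qed.
Lemma subringB : {in M &, forall x y, x - y \in M}.
Proof. by case: M_sub => [[]]. Qed.
Lemma subringM : {in M &, forall x y, x * y \in M}.
Proof. by case: M_sub. Qed.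
Lemma subringD : {in M &, forall x y, x + y \in M}.
Proof.
move=> x y Mx My; rewrite -[y]opprK -(sub0r y).
by apply: subringB => //; apply: subringB => //; apply: subring0.
Qed.
Lemma subringX x n : x \in M -> x ^+ n.+1 \in M.
Proof.
by move=> Mx; elim: n => [|n IHn]; rewrite ?expr1 // exprS; apply: subringM.
Qed.
Lemma subring_sum (I : finType) (F : I -> S) :
  (forall i, F i \in M) -> \sum_i F i \in M.
Proof.
by move=> MF; apply: (big_ind (fun x => x \in M)) => //;
  [apply: subring0 | apply: subringD].
Qed.

End SubringTheory.

Section MaximalSubring.
Variables (S : comPzRingType) (M : {pred S}).
Hypothesis M_max : maximal_subring M.

Lemma maximal_is_subring : is_subring M. Proof. by case: M_max => [[]]. Qed.
Let M_sub := maximal_is_subring.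

Lemma maximal_subring_not_full : ~ (forall x, x \in M).
Proof. by case: M_max => [[_ [x /negP Mx]] _] /(_ x). Qed.

Lemma maximal_subring_sup (N : {pred S}) :
  is_subring N -> {subset M <= N} -> N =i M \/ forall x, x \in N.
Proof.
move=> N_sub MN; have [|Nfull] := pselect (forall x, x \in N); first by right.
by left; apply: (M_max.2) => //; split=> //; apply: contrapT => Nt;
  apply: Nfull => x; apply: contra_notT Nt => Nx; exists x.
Qed.

Lemma maximal_subring_principal a :
  (forall y, a * y \in M) \/
  (forall x, exists2 m, m \in M & exists y, x = m + a * y).
Proof.
pose N : {pred S} :=
  fun x => `[< exists2 m, m \in M & exists y, x = m + a * y >].
have [||NM|Nfull] := @maximal_subring_sup N.
- split; first split.
  + apply/asboolP; exists 0; first exact: subring0.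
    by exists 0; rewrite mulr0 addr0.
  + move=> _ _ /asboolP[m Mm [u ->]] /asboolP[m' Mm' [v ->]]; apply/asboolP.
    exists (m - m'); first exact: subringB.
    by exists (u - v); ring.
  + move=> _ _ /asboolP[m Mm [u ->]] /asboolP[m' Mm' [v ->]]; apply/asboolP.
    exists (m * m'); first exact: subringM.
    by exists (u * m' + m * v + u * (a * v)); ring.
- by move=> x Mx; apply/asboolP; exists x => //; exists 0; rewrite mulr0 addr0.
- left=> y; rewrite -NM; apply/asboolP; exists 0; first exact: subring0.
  by exists y; rewrite add0r.
- by right=> x; have /asboolP := Nfull x.
Qed.

Lemma conductorP x : reflect (forall y, x * y \in M) (x \in conductor M).
Proof. exact: asboolP. Qed.

Lemma conductorMr x z : x \in conductor M -> x * z \in conductor M.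
Proof.
by move=> /conductorP Cx; apply/conductorP => y; rewrite -mulrA.
Qed.

Lemma conductorD : {in conductor M &, forall x y, x + y \in conductor M}.
Proof.
move=> x y /conductorP Cx /conductorP Cy; apply/conductorP => z.
by rewrite mulrDl; apply: subringD.
Qed.

Lemma conductor1 : 1 \notin conductor M.
Proof.
apply/negP => /conductorP C1; apply: maximal_subring_not_full => x.
by rewrite -[x]mul1r.
Qed.

End MaximalSubring.

(** The second hypothesis says that [T] is local with maximal ideal generated by [t]: nilpotence of
    [t] makes every [1 + t w] invertible. The two outcomes correspond to [t T <= M] and
    [M + t T = T]. *)
Lemma maximal_subring_chain (T : comPzRingType) (t : T) n (M : {pred T}) :
    t ^+ n = 0 ->
    (forall x, (exists y, x = t * y) \/ exists y w, x * y = 1 + t * w) ->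
    maximal_subring M ->
  (forall x, x \in conductor M <-> exists y, x = t * y) \/
  (forall x, x \in conductor M <-> exists y, x = t ^+ 2 * y).
Proof.
move=> tn0 t_loc M_max; have M_sub := maximal_is_subring M_max.
have unitP x y w : x * y = 1 + t * w -> x \notin conductor M.
  move=> xy; apply: contra (conductor1 M_max) => Cx.
  have Cxz z : x * z \in conductor M by apply: conductorMr.
  (* The geometric series inverts [1 + t w]; it is finite since [t ^ n = 0]. *)
  have -> : 1 = x * (y * \sum_(i < n) (- (t * w)) ^+ i).
    have := subrXX 1 (- (t * w)) n.
    rewrite expr1n opprK exprNn exprMn tn0 mul0r mulr0 subr0 mulrA xy => {1}->.
    by congr (_ * _); apply: eq_bigr => i _; rewrite expr1n mul1r.
  exact: Cxz.
have [tM|tMT] := maximal_subring_principal M_max t.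
  left=> x; split; last by case=> y ->; apply/conductorMr/conductorP.
  by move=> Cx; have [//|[y [w /unitP]]] := t_loc x; rewrite Cx.
right=> x.
have Ct2 : t ^+ 2 \in conductor M.
  have [/conductorP //|t2MT] := maximal_subring_principal M_max (t ^+ 2).
  (* The case [j = 1] gives [t ^ 2 T <= M], hence [M = T]. The induction is on [n - (j + 1)],
     starting from [t ^ n = 0]. *)
  suff tM j y : t ^+ j.+1 * y \in M.
    case: (maximal_subring_not_full M_max) => z.
    have [m Mm [y ->]] := t2MT z; apply: subringD => //.
  have [le_nj|/ltnW] := leqP n j.+1.
    by rewrite -(subnK le_nj) exprD tn0 mulr0 mul0r subring0.
  move: {2}(n - j.+1)%N (erefl (n - j.+1)%N) => d.
  elim: d j y => [|d IHd] j y.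
    move=> /eqP; rewrite subn_eq0 => nj _.
    by rewrite -(subnK nj) exprD tn0 mulr0 mul0r subring0.
  move=> dE nj.
  have tj2 z : t ^+ j.+2 * z \in M.
    apply: IHd; first by rewrite subnS dE.
    by rewrite -subn_gt0 dE.
  (* From [t = m + t ^ 2 r] comes [m = t (1 - t r)], so [m ^ (j + 1)] and [t ^ (j + 1)] differ by a
     multiple of [t ^ (j + 2)], already known to be in [M]. *)
  have tj1 : t ^+ j.+1 \in M.
    have [m Mm [r tE]] := t2MT t.
    have [z zE] : exists z, (1 - t * r) ^+ j.+1 = 1 + t * z.
      elim: j.+1 => [|i [z zE]]; first by exists 0; rewrite mulr0 addr0.
      by exists (z - r - r * t * z); rewrite exprS zE; ring.
    have -> : t ^+ j.+1 = m ^+ j.+1 - t ^+ j.+2 * z.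
      have -> : m = t * (1 - t * r) by rewrite mulrBr mulr1 {1}tE; ring.
      by rewrite exprMn zE (exprS t j.+1); ring.
    by apply: subringB => //; apply: subringX.
  have [m Mm [r ->]] := t2MT y.
  rewrite mulrDr mulrA -exprD addn2; apply: subringD; first by [].
    exact: subringM.
  by rewrite exprS -mulrA mulrCA; apply: tj2.
split; last by case=> y ->; apply: conductorMr.
move=> Cx; have [[y xE]|[y [w /unitP]]] := t_loc x; last by rewrite Cx.
(* If [y] were a unit modulo [t], then [t] would lie in the conductor, and [M + t T = T] would force
   [M = T]. *)
have [[z yE]|[z [w yE]]] := t_loc y.
  by exists z; rewrite xE yE; ring.
case: (maximal_subring_not_full M_max) => u; have [m Mm [v ->]] := tMT u.
suff /conductorP Ct : t \in conductor M by apply: subringD.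
have -> : t = x * z + t ^+ 2 * (- w).
  by rewrite xE -mulrA yE; ring.
by apply: (conductorD M_max); apply: conductorMr.
Qed.

(** * Maximal subrings of a product *)

Section Product.
Variables (s : nat) (T : 'I_s -> comNzRingType).
Local Notation R := (ring_product T).

Lemma ring_product0 l : (0 : R) l = 0. Proof. by rewrite ffunE. Qed.
Lemma ring_product1 l : (1 : R) l = 1. Proof. by rewrite ffunE. Qed.
Lemma ring_productD (a b : R) l : (a + b) l = a l + b l.
Proof. by rewrite ffunE. Qed.
Lemma ring_productN (a : R) l : (- a) l = - a l.
Proof. by rewrite ffunE. Qed.
Lemma ring_productM (a b : R) l : (a * b) l = a l * b l.
Proof. by rewrite ffunE. Qed.
Lemma ring_productX (a : R) n l : (a ^+ n) l = a l ^+ n.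
Proof.
by elim: n => [|n IHn]; rewrite ?ring_product1 // !exprS ring_productM IHn.
Qed.
Lemma ring_product_sum (J : finType) (G : J -> R) l :
  (\sum_j G j) l = \sum_j G j l.
Proof.
by apply: (big_morph (fun a : R => a l)) => [a b|];
  rewrite ?ring_productD ?ring_product0.
Qed.
Definition ring_productE := (ring_product0, ring_product1, ring_productD,
  ring_productN, ring_productM, ring_productX, ring_product_sum).

Definition single i (x : T i) : R := finfun (dfwith (fun l => 0 : T l) x).

Lemma singleE i (x : T i) : single x i = x.
Proof. by rewrite ffunE dfwith_in. Qed.
Lemma single_out i (x : T i) l : i != l -> single x l = 0.
Proof. by move=> il; rewrite ffunE dfwith_out. Qed.

Lemma single_decomp (a : R) : a = \sum_i single (a i).
Proof.
apply/ffunP => l; rewrite ring_product_sum (bigD1 l) //= singleE.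
by rewrite big1 ?addr0 // => i il; rewrite single_out.
Qed.

Lemma singleM i (x y : T i) : single (x * y) = single x * single y.
Proof.
apply/ffunP => l; rewrite ring_productM; have [<-|il] := eqVneq i l.
  by rewrite !singleE.
by rewrite !single_out // mulr0.
Qed.

Lemma singleB i (x y : T i) : single (x - y) = single x - single y.
Proof.
apply/ffunP => l; rewrite !ring_productE; have [<-|il] := eqVneq i l.
  by rewrite !singleE.
by rewrite !single_out // subr0.
Qed.

(** The idempotent [1 - e_i], where [e_i] is [single 1]. *)
Definition corner i : R := [ffun l => if i == l then 0 else 1].

Lemma cornerE i : corner i i = 0.
Proof. by rewrite ffunE eqxx. Qed.
Lemma corner_out i l : i != l -> corner i l = 1.
Proof. by move=> il; rewrite ffunE (negbTE il). Qed.

Lemma corner_decomp i (a : R) : a = single (a i) + corner i * a.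
Proof.
apply/ffunP => l; rewrite ring_productD ring_productM.
have [<-|il] := eqVneq i l.
  by rewrite singleE cornerE mul0r addr0.
by rewrite single_out // corner_out // mul1r add0r.
Qed.

Variable M : {pred R}.
Hypothesis M_max : maximal_subring M.
Let M_sub := maximal_is_subring M_max.

(** Once [(1 - e_i) R <= M], membership in [M] depends on coordinate [i] alone, and subrings of
    [T i] above [Mi] pull back to subrings of [R] above [M]. *)
Lemma factor_maximal i : (forall y, corner i * y \in M) ->
  let Mi : {pred T i} := fun x => single x \in M in
  maximal_subring Mi /\ forall a, (a \in M) = (a i \in Mi).
Proof.
move=> cM Mi.
have Mi_eq a : (a \in M) = (a i \in Mi).
  apply/idP/idP => Ma; last first.
    by rewrite (corner_decomp i a); apply: subringD.
  have -> : (a i \in Mi) = (single (a i) \in M) by [].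
  have -> : single (a i) = a - corner i * a.
    by rewrite {2}(corner_decomp i a) addrK.
  exact: subringB.
have Mi_sub : is_subring Mi.
  have MiE x : (x \in Mi) = (single x \in M) by [].
  split; first split.
  - have -> : 0 = (0 : R) i by rewrite ring_product0.
    by rewrite -Mi_eq subring0.
  - by move=> x y; rewrite !MiE singleB; apply: subringB.
  - by move=> x y; rewrite !MiE singleM; apply: subringM.
split=> //; split.
  split=> //; have [[_ [x Mx]] _] := M_max.
  by exists (x i); rewrite -Mi_eq.
move=> N [N_sub [x Nx]] MiN.
pose N' : {pred R} := fun a => a i \in N.
have N'E a : (a \in N') = (a i \in N) by [].
have [||N'M|N'full] := @maximal_subring_sup _ _ M_max N'.
- split; first split.
  + by rewrite N'E ring_product0; apply: subring0.
  + by move=> a b; rewrite !N'E ring_productD ring_productN; apply: subringB.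
  + by move=> a b; rewrite !N'E ring_productM; apply: subringM.
- by move=> a; rewrite Mi_eq N'E; apply: MiN.
- move=> y; have := N'M (single y).
  by rewrite N'E Mi_eq singleE.
- by have := N'full (single x); rewrite N'E singleE (negbTE Nx).
Qed.

(** * Factors with residue field [F i] and nilpotent uniformizer [t i] *)

Variables (F : 'I_s -> comNzRingType) (f : forall i, {rmorphism T i -> F i}).
Variables (t : forall i, T i) (k : 'I_s -> nat).
Hypothesis t_nil : forall i, t i ^+ k i = 0.
Hypothesis f_surj : forall i y, exists x, f i x = y.
Hypothesis f_ker : forall i x, f i x = 0 <-> exists y, x = t i * y.
Hypothesis F_field : forall i (x : F i), x != 0 -> exists y, x * y = 1.

Lemma factor_chain i (x : T i) :
  (exists y, x = t i * y) \/ exists y w, x * y = 1 + t i * w.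
Proof.
have [/f_ker|/F_field[z xz]] := eqVneq (f i x) 0; first by left.
right; have [y yz] := f_surj z.
have /f_ker[w yw] : f i (x * y - 1) = 0.
  by rewrite rmorphB rmorphM rmorph1 yz xz subrr.
by exists y, w; rewrite -yw addrC subrK.
Qed.

Lemma corner_in_conductor i :
    (forall x, exists2 m, m \in M & exists y, x = m + single (t i) * y) ->
  forall y, corner i * y \in M.
Proof.
move=> MtR.
have cM : corner i \in M.
  have [m Mm [y cE]] := MtR (corner i).
  (* On coordinate [i], [m] is a multiple of the nilpotent [t i]; elsewhere it is 1. The exponent is
     kept positive because [M] may lack 1. *)
  suff -> : corner i = m ^+ (k i).+1 by apply: subringX.
  have -> : m = corner i - single (t i) * y by rewrite cE addrK.
  apply/ffunP => l.
  rewrite !(ring_productX, ring_productD, ring_productN, ring_productM).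
  have [<-|il] := eqVneq i l.
    rewrite cornerE singleE add0r exprNn exprMn (exprS (t i)) t_nil.
    by rewrite mulr0 mul0r mulr0.
  by rewrite corner_out // single_out // mul0r subr0 expr1n.
move=> y; have [m Mm [z ->]] := MtR y.
suff -> : corner i * (m + single (t i) * z) = corner i * m by apply: subringM.
apply/ffunP => l; rewrite !(ring_productD, ring_productM).
have [<-|il] := eqVneq i l; first by rewrite cornerE !mul0r.
by rewrite single_out // mul0r addr0.
Qed.

(** * Goursat's argument on the residue fields *)

Section Goursat.
Hypothesis M_surj : forall i x, exists2 m, m \in M & m i = x.
Hypothesis M_ker : forall a : R, (forall i, f i (a i) = 0) -> a \in M.

Definition separated i j :=
  exists m, [/\ m \in M, f i (m i) = 1 & f j (m j) = 0].

Lemma separated_sym i j : separated i j -> separated j i.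
Proof.
case=> m [Mm mi mj]; have [m1 Mm1 m1j] := M_surj (1 : T j).
(* This is [(1 - m) m1], with [m1] standing in for 1, which [M] may lack. *)
exists (m1 - m * m1); split.
- by apply: subringB => //; apply: subringM.
- by rewrite !ring_productE m1j mulr1 rmorphB mj rmorph1 subr0.
- by rewrite !ring_productE rmorphB rmorphM mi mul1r subrr.
Qed.

Lemma separatedI i j m :
  m \in M -> f i (m i) != 0 -> f j (m j) = 0 -> separated i j.
Proof.
move=> Mm /F_field[z mz] mj; have [x xz] := f_surj z.
have [m' Mm' m'i] := M_surj x.
exists (m * m'); split; first exact: subringM.
- by rewrite ring_productM rmorphM m'i xz mz.
- by rewrite ring_productM rmorphM mj mul0r.
Qed.

(** Were all pairs separated, products of separating elements would give members of [M] reducing to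
    each idempotent of the product of the residue fields. By [M_surj], [M] would map onto that
    product, and [M_ker] would make it all of [R]. *)
Lemma not_all_separated : exists i j : 'I_s, (i < j)%N /\ ~ separated i j.
Proof.
apply: contrapT => nsep.
have sep i j : i != j -> separated i j.
  rewrite neq_ltn => /orP[ij|ji].
    by apply: contrapT => nij; apply: nsep; exists i, j.
  by apply: separated_sym; apply: contrapT => nij; apply: nsep; exists j, i.
have sepl i (r : seq 'I_s) : i \notin r ->
    exists m, [/\ m \in M, f i (m i) = 1 & forall j, j \in r -> f j (m j) = 0].
  elim: r => [_|j r IHr].
    have [m Mm m1] := M_surj (1 : T i).
    by exists m; split=> //; rewrite m1 rmorph1.
  rewrite inE negb_or => /andP[/sep[m [Mm mi mj]] /IHr[m' [Mm' m'i m'r]]].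
  exists (m * m'); split; first exact: subringM.
    by rewrite ring_productM rmorphM mi m'i mulr1.
  move=> l; rewrite inE ring_productM rmorphM.
  by move=> /predU1P[->|/m'r->]; rewrite ?mj ?mul0r ?mulr0.
have unit i : exists m, [/\ m \in M, f i (m i) = 1 &
    forall j, j != i -> f j (m j) = 0].
  have [|m [Mm mi mj]] := sepl i [seq j <- enum 'I_s | j != i].
    by rewrite mem_filter eqxx.
  exists m; split=> // j ji; apply: mj.
  by rewrite mem_filter ji mem_enum.
case: (maximal_subring_not_full M_max) => a.
have [e eP] := choice unit.
have lift i : exists m, m \in M /\ m i = a i.
  by have [m Mm mi] := M_surj (a i); exists m.
have [b bP] := choice lift.
rewrite -(subrK (\sum_i e i * b i) a); apply: subringD => //; last first.
  by apply: subring_sum => // i; apply: subringM => //;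
    [case: (eP i) | case: (bP i)].
apply: M_ker => l; rewrite !ring_productE rmorphB raddf_sum (bigD1 l) //=.
rewrite big1 => [|i il]; rewrite ring_productM rmorphM.
  by case: (eP l) => _ -> _; case: (bP l) => _ ->; rewrite mul1r addr0 subrr.
by case: (eP i) => _ _ ->; rewrite ?mul0r // eq_sym.
Qed.

(** For a pair that is not separated, an element of [M] vanishes in [F i] exactly when it vanishes
    in [F j], so the image of [M] in the product of these two fields is the graph of an
    isomorphism. *)
Lemma goursat i j : i != j -> ~ separated i j ->
  exists2 sigma : {rmorphism F i -> F j}, bijective sigma &
    forall a, a \in M <-> f j (a j) = sigma (f i (a i)).
Proof.
move=> ij nsep.
have ker m : m \in M -> f i (m i) = 0 <-> f j (m j) = 0.
  move=> Mm; split=> m0; apply/eqP; apply: contraT => mn0; case: nsep.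
    by apply: separated_sym; apply: separatedI mn0 m0.
  exact: separatedI mn0 m0.
have inj m m' : m \in M -> m' \in M ->
    f i (m i) = f i (m' i) <-> f j (m j) = f j (m' j).
  move=> Mm Mm'; have := ker _ (subringB M_sub Mm Mm').
  rewrite !ring_productE !rmorphB => kmm'.
  by split=> mm'; apply/eqP; rewrite -subr_eq0; apply/eqP/kmm'/eqP;
    rewrite subr_eq0; apply/eqP.
(* [N] is the preimage of that image: a subring above [M] without [single 1], which would separate
   [i] from [j]. By maximality it is [M]. *)
pose N : {pred R} := fun a => `[< exists m,
  [/\ m \in M, f i (m i) = f i (a i) & f j (m j) = f j (a j)] >].
have NP (a : R) : reflect (exists m, [/\ m \in M, f i (m i) = f i (a i)
    & f j (m j) = f j (a j)]) (a \in N) by apply: asboolP.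
have NM : N =i M.
  have [||//|Nfull] := @maximal_subring_sup _ _ M_max N.
  - split; first split.
    + by apply/NP; exists 0; rewrite subring0.
    + move=> a b /NP[m [Mm mi mj]] /NP[m' [Mm' m'i m'j]]; apply/NP.
      by exists (m - m'); rewrite subringB //
        !ring_productE !rmorphB mi mj m'i m'j.
    + move=> a b /NP[m [Mm mi mj]] /NP[m' [Mm' m'i m'j]]; apply/NP.
      by exists (m * m'); rewrite subringM //
        !ring_productE !rmorphM mi mj m'i m'j.
  - by move=> a Ma; apply/NP; exists a.
  - have /NP[m [Mm]] := Nfull (single (1 : T i)).
    rewrite singleE single_out // rmorph1 rmorph0 => mi mj.
    by case: nsep; exists m.
have lift l (x : F l) : exists m, m \in M /\ f l (m l) = x.
  have [y <-] := f_surj x; have [m Mm mE] := M_surj y.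
  by exists m; rewrite mE.
have [g gP] := choice (lift i); have [h hP] := choice (lift j).
pose sg x := f j (g x j); pose tau y := f i (h y i).
have sgE m : m \in M -> sg (f i (m i)) = f j (m j).
  by move=> Mm; have [Mg gE] := gP (f i (m i)); apply/inj.
have tauE m : m \in M -> tau (f j (m j)) = f i (m i).
  by move=> Mm; have [Mg gE] := hP (f j (m j)); apply/inj.
have sgB : zmod_morphism sg.
  move=> x y; have [[Mx {1}<-] [My {1}<-]] := (gP x, gP y).
  have := sgE _ (subringB M_sub Mx My).
  by rewrite !ring_productE !rmorphB.
have sgM : monoid_morphism sg.
  split=> [|x y].
    (* As [M] may lack 1, [sg 1] is identified as a nonzero idempotent of a field. *)
    have [m Mm m1] := M_surj (1 : T i).
    have sg1 : sg 1 = f j (m j) by rewrite -sgE // m1 rmorph1.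
    have mm : f j (m j) = f j (m j) * f j (m j).
      by rewrite -rmorphM -ring_productM; apply/inj; rewrite ?subringM //
        ring_productM m1 mulr1.
    have : f j (m j) != 0.
      by apply/eqP => /ker; rewrite m1 rmorph1 => /(_ Mm)/eqP; rewrite oner_eq0.
    move=> /F_field[z mz]; rewrite sg1 -[LHS]mulr1 -mz mulrA -mm.
    by rewrite mz.
  have [[Mx {1}<-] [My {1}<-]] := (gP x, gP y).
  have := sgE _ (subringM M_sub Mx My).
  by rewrite !ring_productE !rmorphM.
pose sA := GRing.isZmodMorphism.Build _ _ sg sgB.
pose sM := GRing.isMonoidMorphism.Build _ _ sg sgM.
pose sigma : {rmorphism F i -> F j} := HB.pack sg sA sM.
exists sigma => [|a].
  exists tau => [x|y] /=.
    by have [Mx {1 2}<-] := gP x; rewrite sgE // tauE.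
  by have [My {1 2}<-] := hP y; rewrite tauE // sgE.
split=> [Ma|aE]; first by rewrite /= sgE.
rewrite -NM; apply/NP; have [Mm mE] := gP (f i (a i)).
by exists (g (f i (a i))).
Qed.

End Goursat.

Lemma maximal_subring_product :
  (exists i (Mi : {pred T i}),
     [/\ maximal_subring Mi, forall a, (a \in M) = (a i \in Mi) &
       (forall x, x \in conductor Mi <-> exists y, x = t i * y) \/
       (forall x, x \in conductor Mi <-> exists y, x = t i ^+ 2 * y)])
  \/
  (exists i j : 'I_s, (i < j)%N /\
     exists2 sigma : {rmorphism F i -> F j}, bijective sigma &
       forall a, a \in M <-> f j (a j) = sigma (f i (a i))).
Proof.
have [[i cM]|ncM] := pselect (exists i, forall y, corner i * y \in M).
  left; have [Mi_max Mi_eq] := factor_maximal cM.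
  exists i; eexists; split; [exact: Mi_max|exact: Mi_eq|].
  exact: maximal_subring_chain (t_nil i) (@factor_chain i) Mi_max.
right.
have M_surj i (x : T i) : exists2 m, m \in M & m i = x.
  have [cM|] := maximal_subring_principal M_max (corner i).
    by case: ncM; exists i.
  move=> /(_ (single x))[m Mm [y xE]]; exists m => //.
  by rewrite -(singleE x) xE ring_productD ring_productM cornerE mul0r addr0.
(* If some [e_i t_i R] were not inside [M], then [M + e_i t_i R = R] would put [(1 - e_i) R] inside
   [M], against [ncM]. *)
have M_ker (a : R) : (forall i, f i (a i) = 0) -> a \in M.
  move=> a0; rewrite (single_decomp a); apply: subring_sum => // i.
  have /f_ker[y ->] := a0 i; rewrite singleM.
  have [//|/corner_in_conductor cM] :=
    maximal_subring_principal M_max (single (t i)).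
  by case: ncM; exists i.
have [i [j [ij nsep]]] := not_all_separated M_surj M_ker.
exists i, j; split=> //; apply: goursat nsep => //.
by rewrite neq_ltn ij.
Qed.

End Product.

(** * Primes of a ring of integers *)

Lemma ndvdz_inv (p : nat) (c : int) : prime p -> ~~ (p %| c)%Z ->
  exists d e : int, c * d = 1 + p%:Z * e.
Proof.
move=> p_pr pc; have /coprimezP[[u v] /= uv] : coprimez p c.
  by rewrite coprimezE absz_nat prime_coprime // -[p]absz_nat -dvdzE.
by exists v, (- u); rewrite -uv; ring.
Qed.

(** * Integer relations with a coefficient prime to [p] *)

Section IntegerRelations.
Variables (K : fieldExtType rat) (p : nat).
Hypothesis p_pr : prime p.

Lemma ext_natr_eq0 n : (n%:R == 0 :> K) = (n == 0).
Proof. by rewrite -(rmorph_nat (in_alg K)) fmorph_eq0 Num.Theory.pnatr_eq0. Qed.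

(* A rational relation, cleared of denominators and of common factors p. *)
Lemma ext_relation (x : nat -> K) : let N := (\dim {:K}).+1 in
  exists2 c : nat -> int, exists2 i, (i < N)%N & ~~ (p %| c i)%Z &
    \sum_(i < N) (c i)%:~R * x i = 0.
Proof.
move=> N; pose X := [tuple x i | i < N].
have /freeP : ~~ free X.
  rewrite /free size_tuple neq_ltn; apply/orP; left; rewrite ltnS.
  by apply: dimvS; apply: subvf.
move=> /existsNP[q /not_implyP[qX /existsNP[i0 /eqP qi0]]].
pose c0 i := numq (q i) * \prod_(j | j != i) denq (q j).
have c0E i : (c0 i)%:~R = (\prod_j denq (q j))%:~R * q i.
  by rewrite [in RHS](bigD1 i) //= !intrM numqE; ring.
have [c ci0 cX] : exists2 c : 'I_N -> int, c i0 != 0 &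
    \sum_i (c i)%:~R * x i = 0 :> K.
  exists c0.
    rewrite mulf_neq0 ?numq_eq0 //; apply/prodf_neq0 => j _.
    exact: denq_neq0.
  have := congr1 (fun u => (\prod_j denq (q j))%:~R *: u) qX.
  rewrite scaler0 scaler_sumr => {2}<-; apply: eq_bigr => i _.
  rewrite scalerA -c0E -tnth_nth tnth_mktuple.
  by rewrite scaler_int mulrzl.
(* While [p] divides all coefficients, dividing them by [p] shrinks the nonzero [c i0]. *)
have [n] := ubnP `|c i0|; elim: n c ci0 cX => // n IHn c ci0 cX.
rewrite ltnS => cn.
have [/existsP[i ci]|] := boolP [exists i, ~~ (p %| c i)%Z].
  exists (fun i => oapp c 0 (insub i)).
    exists i => //; rewrite insubT //= => ?.
    by rewrite (_ : Sub _ _ = i) //; apply: val_inj.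
  rewrite -[RHS]cX; apply: eq_bigr => j _; congr (_ %:~R * _).
  by rewrite valK.
rewrite negb_exists => /forallP pc.
have {}pc i : (c i %/ p)%Z * p = c i by apply: divzK; rewrite -[_ _ _]negbK pc.
apply: (IHn (fun i => (c i %/ p)%Z)).
- by apply: contraNneq ci0 => ci0; rewrite -pc ci0 mul0r.
- have : p%:R != 0 :> K by rewrite ext_natr_eq0 -lt0n prime_gt0.
  move=> /mulfI; apply; rewrite mulr0 mulr_sumr -[RHS]cX; apply: eq_bigr => i _.
  by rewrite -{2}[c i]pc intrM mulrA [_ * p%:R]mulrC.
- apply: leq_trans cn; rewrite -{2}[c i0]pc abszM absz_nat.
  rewrite ltn_Pmulr ?prime_gt1 //.
  by rewrite absz_gt0; apply: contraNneq ci0 => ci0; rewrite -pc ci0 mul0r.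
Qed.

End IntegerRelations.

(** * Finite bases over the field with [p] elements *)

Section BasisModPrime.
Variables (V : zmodType) (p N : nat) (W : {pred V}) (D : zmodClosed V).
Hypothesis p_pr : prime p.
Hypothesis pV : forall x : V, x *+ p \in D.
Hypothesis bounded : forall x : nat -> V, exists2 c : nat -> int,
  exists2 i, (i < N)%N & ~~ (p %| c i)%Z & \sum_(i < N) x i *~ c i \in D.

(** [V / D] is a vector space over the field with [p] elements whose independent families have
    bounded length, so a longest one in [W] generates [W] modulo [D]. This serves both for [P]
    modulo [p A] and for the residue field. *)
Lemma exists_basis_mod : exists m (b : nat -> V),
  [/\ forall i, (i < m)%N -> b i \in W,
      forall c : nat -> int, \sum_(i < m) b i *~ c i \in D ->
        forall i, (i < m)%N -> (p %| c i)%Z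
    & forall w, w \in W -> exists c : nat -> int,
        w - \sum_(i < m) b i *~ c i \in D].
Proof.
pose indep (m : nat) := `[< exists b : nat -> V,
  (forall i, (i < m)%N -> b i \in W) /\
  forall c : nat -> int, \sum_(i < m) b i *~ c i \in D ->
        forall i, (i < m)%N -> (p %| c i)%Z >].
have indep0 : exists m, indep m.
  by exists 0; apply/asboolP; exists (fun=> 0).
have indepN m : indep m -> (m <= N)%N.
  move=> /asboolP[b [_ bP]]; rewrite leqNgt; apply/negP => Nm.
  have [c [i iN /negP ci] cD] := bounded b; apply: ci.
  have := bP (fun i => if (i < N)%N then c i else 0) _ i (ltn_trans iN Nm).
  rewrite iN; apply; rewrite -(big_mkord xpredT
    (fun i => b i *~ (if (i < N)%N then c i else 0))).
  rewrite (@big_cat_nat _ _ _ N) //=; last exact: ltnW.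
  rewrite big_mkord.
  rewrite (eq_bigr (fun i : 'I_N => b i *~ c i)) => [|j _]; last first.
    by rewrite ltn_ord.
  rewrite big_nat [X in _ + X]big1 ?addr0 // => j /andP[Nj _].
  by rewrite ltnNge Nj.
have [m /asboolP[b [bW bP]] mP] := ex_maxnP indep0 indepN.
exists m, b; split=> // w Ww; apply: contrapT => nc.
suff /mP : indep m.+1 by rewrite ltnn.
pose b' i := if (i < m)%N then b i else w.
have sumb' (c : nat -> int) :
    \sum_(i < m.+1) b' i *~ c i = \sum_(i < m) b i *~ c i + w *~ c m.
  rewrite big_ord_recr /= {2}/b' ltnn; congr (_ + _).
  by apply: eq_bigr => i _; rewrite /b' ltn_ord.
apply/asboolP; exists b'; split.
  by move=> i _; rewrite /b'; case: ifP => // /bW.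
move=> c; rewrite sumb' => cD.
(* Otherwise inverting [c m] modulo [p] would express [w] through the [b i] modulo [D]. *)
have pcm : (p %| c m)%Z.
  apply: contraT => /(ndvdz_inv p_pr)[d [e de]]; case: nc.
  exists (fun i => - (c i * d)).
  have -> : \sum_(i < m) b i *~ - (c i * d) =
      - ((\sum_(i < m) b i *~ c i) *~ d).
    rewrite mulrz_suml -sumrN; apply: eq_bigr => i _.
    by rewrite mulrNz mulrzA.
  have := rpredMz d cD; rewrite opprK mulrzDl -mulrzA de mulrzDr mulr1z.
  rewrite mulrzA -pmulrn => wD.
  have := rpredB wD (rpredMz e (pV w)).
  by rewrite addrA addrK addrC.
move=> i; rewrite ltnS leq_eqVlt => /predU1P[-> //|]; apply: bP.
have [e cmE] := dvdzP pcm; move: cD; rewrite cmE mulrC mulrzA -pmulrn.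
by rewrite rpredDr // rpredMz.
Qed.

End BasisModPrime.

(** The proof takes for [c] the lowest coefficient prime to [p], at index [n]; the terms below it go
    into [p y]. *)
Lemma horner_split (R : comNzRingType) (p : nat) (q : {poly int}) (x : R) :
  (exists i, ~~ (p %| q`_i)%Z) ->
  exists n (c : int) r y, ~~ (p %| c)%Z /\
    (map_poly intr q).[x] = x ^+ n * (c%:~R + x * r) + p%:R * y.
Proof.
elim/poly_ind: q => [[i]|q c IHq [i qi]]; first by rewrite coef0 dvdz0.
rewrite rmorphD rmorphM /= map_polyX map_polyC /= hornerMXaddC.
have [pc|pc] := boolP (p %| c)%Z; last first.
  by exists 0%N, c, (map_poly intr q).[x], 0; split=> //; ring.
have [|n [d [r [y [pd ->]]]]] := IHq.
  case: i qi => [|i]; rewrite coefD coefMX coefC /= ?add0r ?pc //.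
  by rewrite addr0; exists i.
have [e ->] := dvdzP pc.
by exists n.+1, d, r, (y * x + e%:~R); split=> //; rewrite intrM exprS; ring.
Qed.

(** * Relations modulo [p] and integrality *)

Section RingOfIntegers.
Variables (K : fieldExtType rat) (p : nat).
Hypothesis p_pr : prime p.
Local Notation A := (ring_of_integers K).
Local Notation AI := (@algebraic_integer K).
Local Notation dimK := (\dim {:K}).

Lemma ri_valP (x : A) : integralOver (intr : int -> K) (\val x).
Proof. by apply/asboolP/(valP x). Qed.

Lemma ri_lift (x : K) : integralOver (intr : int -> K) x ->
  exists y : A, \val y = x.
Proof. by move=> /asboolP xA; exists (Sub x xA); rewrite SubK. Qed.

Lemma ri_natr_mulI (y z : A) : p%:R * y = p%:R * z -> y = z.
Proof.
move=> /(congr1 val); rewrite !rmorphM !rmorph_nat => pyz.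
apply: val_inj; apply: mulfI pyz.
by rewrite ext_natr_eq0 -lt0n prime_gt0.
Qed.

Lemma ri_relation (x : nat -> A) :
  exists2 c : nat -> int, exists2 i, (i < dimK.+1)%N & ~~ (p %| c i)%Z &
    \sum_(i < dimK.+1) x i *~ c i = 0.
Proof.
have [c ci cx] := ext_relation p_pr (fun i => \val (x i)).
exists c => //; apply: val_inj; rewrite raddf_sum raddf0 -[RHS]cx.
by apply: eq_bigr => i _; rewrite raddfMz /= mulrzl.
Qed.

(** Splits a monic equation of [x], whose leading coefficient 1 is prime to [p]. For [x] outside [P]
    this yields an inverse modulo [P]; for [x] in [P] the second factor is outside [P] and kills a
    power of [x] modulo [p]. *)
Lemma ri_pow_split (x : A) : exists n (c : int) r y,
  ~~ (p %| c)%Z /\ x ^+ n * (c%:~R + x * r) = p%:R * y.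
Proof.
have [q q_mon qx] := ri_valP x.
have [|n [c [r [y [pc qE]]]]] := @horner_split A p q x.
  exists (size q).-1; rewrite -/(lead_coef q) (monicP q_mon).
  by rewrite dvdz1 absz_nat; apply: contraTneq p_pr => ->.
exists n, c, r, (- y); split=> //; apply/eqP; rewrite mulrN -addr_eq0 -qE.
apply/eqP/val_inj; rewrite raddf0; move/rootP: qx => <-.
rewrite -horner_map; congr _.[_]; apply/polyP => i.
by rewrite !coef_map; apply: rmorph_int.
Qed.

(* The relation among g, ..., g ^ N, scaled so that its last coefficient prime
   to p is 1, is monic modulo terms p g ^ i, which are integral. *)
Lemma almost_integral (g : K) :
    (forall i, exists y : A, \val y = p%:R * g ^+ i) ->
  integralOver (intr : int -> K) g.
Proof.
move=> gA.
have pgA i : p%:R * g ^+ i \in AI by have [y <-] := gA i; apply: valP.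
have [c [j jN pcj] cg] := ext_relation p_pr (fun i => g ^+ i.+1).
have exP : exists i, (i < dimK.+1)%N && ~~ (p %| c i)%Z by exists j; rewrite jN.
have ubP i : (i < dimK.+1)%N && ~~ (p %| c i)%Z -> (i <= dimK)%N.
  by rewrite ltnS => /andP[].
have [l /andP[lN pcl] lmax] := ex_maxnP exP ubP.
have [d [e de]] := ndvdz_inv p_pr pcl.
pose a := g ^+ l.+1 + \sum_(i < l) (c i * d)%:~R * g ^+ i.+1.
(* In the relation scaled by [d], the coefficient at [l] is [1 + p e] and the later ones are
   multiples of [p] by maximality of [l]; so [a] is an integer combination of elements [p g ^ i]. *)
have aA : a \in AI.
  have -> : a = (p%:R * g ^+ l.+1) * (- e)%:~R
      - \sum_(l.+1 <= i < dimK.+1) (c i * d)%:~R * g ^+ i.+1.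
    apply/eqP; rewrite -subr_eq0; apply/eqP.
    rewrite -[RHS](mulr0 d%:~R) -[in RHS]cg mulr_sumr.
    rewrite -(big_mkord xpredT (fun i => d%:~R * ((c i)%:~R * g ^+ i.+1))).
    rewrite [X in _ = X](@big_cat_nat _ _ _ l) //=; last exact: ltnW.
    rewrite [X in _ = _ + X]big_ltn // big_mkord.
    have clE : d%:~R * ((c l)%:~R * g ^+ l.+1) =
        (1 + p%:R * e%:~R) * g ^+ l.+1 :> K.
      by rewrite mulrA -intrM [d * _]mulrC de intrD intrM.
    have sE i : d%:~R * ((c i)%:~R * g ^+ i.+1) =
        (c i * d)%:~R * g ^+ i.+1 :> K.
      by rewrite intrM mulrA [d%:~R * _]mulrC.
    rewrite clE (eq_bigr _ (fun i _ => sE i)).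
    rewrite (eq_bigr _ (fun (i : 'I_l) _ => sE i)) /a; ring.
  rewrite rpredB //; first by apply: rpredM; [apply: pgA | apply: rpred_int].
  rewrite big_nat; apply: rpred_sum => i /andP[li iN].
  have /dvdzP[z ->] : (p %| c i)%Z.
    by apply: contraLR li => pci; rewrite -leqNgt lmax // iN.
  have -> : (z * p * d)%:~R * g ^+ i.+1 = (z * d)%:~R * (p%:R * g ^+ i.+1) :> K.
    by rewrite !intrM pmulrn; ring.
  by apply: rpredM; [apply: rpred_int | apply: pgA].
(* The constant coefficient [- a] makes [g] a root of the monic [Q]. *)
pose G i := if i is i'.+1 then (c i' * d)%:~R else - a.
pose Q : {poly K} := 'X^(l.+1) + \poly_(i < l.+1) G i.
apply: (@integral_root_monic _ _ _ g Q).
- rewrite monicE lead_coefDl ?lead_coefXn // size_polyXn.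
  exact: leq_trans (size_poly _ _) _.
- apply/rootP; rewrite hornerD hornerXn horner_poly big_ord_recl /=.
  by rewrite expr0 mulr1 addrCA; apply: addNr.
- apply: (iffLR (integral_poly _ _)) => i; apply/asboolP.
  rewrite coefD coefXn coef_poly.
  apply: (@rpredD _ AI); first exact: rpred_nat.
  case: ifP => _; last exact: rpred0.
  by case: i => [|i] /=; rewrite ?rpredN // rpred_int.
Qed.

End RingOfIntegers.

(** * A prime over [p] is locally principal *)

Section PrimeIdeal.
Variables (K : fieldExtType rat) (p : nat).
Hypothesis p_pr : prime p.
Local Notation A := (ring_of_integers K).
Variable P : prime_idealr A.
Hypothesis P_p : lies_over P p.

Definition pA : {pred A} := fun x => `[< exists y, x = p%:R * y >].

Lemma pAP x : reflect (exists y, x = p%:R * y) (x \in pA).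
Proof. exact: asboolP. Qed.

Lemma pA_zmod : zmod_closed pA.
Proof.
split=> [|x y /pAP[x' ->] /pAP[y' ->]]; apply/pAP.
  by exists 0; rewrite mulr0.
by exists (x' - y'); rewrite mulrBr.
Qed.
HB.instance Definition _ := GRing.isZmodClosed.Build A pA pA_zmod.

Lemma pAMl x y : x \in pA -> y * x \in pA.
Proof. by move=> /pAP[z ->]; apply/pAP; exists (y * z); rewrite mulrCA. Qed.

Lemma prime_natr_in : p%:R \in (P : {pred A}).
Proof. by have := P_p p; rewrite dvdzz pmulrn. Qed.

Lemma prime_pA x : x \in pA -> x \in (P : {pred A}).
Proof. by move=> /pAP[y ->]; rewrite mulrC idealMr // prime_natr_in. Qed.

Lemma prime_exp x n : x ^+ n.+1 \in (P : {pred A}) -> x \in (P : {pred A}).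
Proof.
by elim: n => [//|n IHn]; rewrite exprS prime_idealrM => /orP[].
Qed.

Lemma prime_coef c x r : ~~ (p %| c)%Z -> x \in (P : {pred A}) ->
  c%:~R + x * r \notin (P : {pred A}).
Proof.
by move=> pc Px; rewrite rpredDr ?P_p // mulrC idealMr.
Qed.

(** In [x ^ n (c + x r) = p y], an [x] outside [P] forces [c + x r] into [P], and [c] is invertible
    modulo [p]. *)
Lemma prime_maximal x : x \notin (P : {pred A}) ->
  exists z, 1 - x * z \in (P : {pred A}).
Proof.
move=> Px; have [n [c [r [y [pc xE]]]]] := ri_pow_split p_pr x.
have Pu : c%:~R + x * r \in (P : {pred A}).
  have : x ^+ n * (c%:~R + x * r) \in (P : {pred A}).
    by apply: prime_pA; apply/pAP; exists y.
  rewrite prime_idealrM => /orP[|//].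
  by case: n {xE} => [|n /prime_exp]; rewrite ?idealr1 // (negbTE Px).
have [d [e de]] := ndvdz_inv p_pr pc.
exists (- r * d%:~R).
have -> : 1 - x * (- r * d%:~R) = d%:~R * (c%:~R + x * r) - e%:~R * p%:R.
  rewrite mulrDr -intrM [d * c]mulrC de intrD intrM -pmulrn; ring.
by rewrite rpredB // idealMr // prime_natr_in.
Qed.

(** [L] represents a basis of [P] modulo [p A]; generation is stated only as a test of whether [P]
    kills [b] modulo [p]. *)
Lemma prime_generated : exists L : seq A,
  {subset L <= (P : {pred A})} /\
  forall b, (forall x, x \in L -> x * b \in pA) ->
    forall x, x \in (P : {pred A}) -> x * b \in pA.
Proof.
have [|x|m [b [bP _ bgen]]] :=
  @exists_basis_mod _ p (\dim {:K}).+1 (P : {pred A}) pA p_pr.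
- by move=> x; apply/pAP; exists x; rewrite mulr_natl.
- have [c ci cx] := ri_relation p_pr x.
  by exists c => //; rewrite cx rpred0.
exists [seq b i | i <- iota 0 m]; split.
  by move=> _ /mapP[i + ->]; rewrite mem_iota => /bP.
move=> u uP x /bgen[c cD].
rewrite -[x](subrK (\sum_(i < m) b i *~ c i)) mulrDl.
apply: rpredD; first by rewrite mulrC pAMl.
rewrite mulr_suml; apply: rpred_sum => i _; rewrite mulrzAl rpredMz // uP //.
by apply/mapP; exists (val i); rewrite // mem_iota ltn_ord.
Qed.

(** Provides the numerator of [g = b / p], which is not integral although [g P <= A]. *)
Lemma prime_socle : exists2 b, b \notin pA &
  forall x, x \in (P : {pred A}) -> x * b \in pA.
Proof.
have [L [LP Lgen]] := prime_generated.
suff [b [pb bL]] : exists b, b \notin pA /\ forall x, x \in L -> x * b \in pA.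
  by exists b => // x; apply: Lgen.
(* Some u outside P makes every generator x of P nilpotent: u x ^ n is in p A;
   multiplying u by maximal nonvanishing powers of the generators then gives an
   element killed by all of them. *)
have [u Pu uL] : exists2 u, u \notin (P : {pred A}) &
    forall x, x \in L -> exists n, u * x ^+ n \in pA.
  elim: L LP {Lgen} => [|x L IHL] LP; first by exists 1; rewrite ?idealr1.
  have [|u Pu uL] := IHL; first by move=> y Ly; rewrite LP // inE Ly orbT.
  have [n [c [r [y [pc xE]]]]] := ri_pow_split p_pr x.
  exists (u * (c%:~R + x * r)).
    rewrite prime_idealrM negb_or Pu prime_coef // LP ?mem_head //.
  move=> z; rewrite inE => /predU1P[->|/uL[k uk]].
    exists n; rewrite -mulrA [_ * x ^+ n]mulrC xE; apply/pAP.
    by exists (u * y); rewrite mulrCA.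
  by exists k; rewrite mulrAC mulrC pAMl.
have {Pu} pu : u \notin pA by apply: contra Pu => /prime_pA.
suff [g [pg gL]] : exists g, u * g \notin pA /\
    forall x, x \in L -> x * (u * g) \in pA by exists (u * g).
elim: L u uL pu {LP Lgen} => [|x L IHL] u uL pu.
  by exists 1; rewrite mulr1.
have xP : exists n, u * x ^+ n \in pA by apply: uL; rewrite mem_head.
have [n un nmin] := ex_minnP xP.
have n0 : (0 < n)%N by case: n un {nmin} => //; rewrite mulr1 (negbTE pu).
have [||g [pg gL]] := IHL (u * x ^+ n.-1).
- move=> y Ly; have [|k uk] := uL y; first by rewrite inE Ly orbT.
  by exists k; rewrite mulrAC mulrC pAMl.
- by apply/negP => /nmin; rewrite leqNgt prednK // leqnn.
exists (x ^+ n.-1 * g); rewrite mulrA; split=> // y.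
rewrite inE => /predU1P[->|/gL //].
have -> : x * (u * x ^+ n.-1 * g) = g * (u * x ^+ n).
  by rewrite -[in RHS](prednK n0) exprS; ring.
exact: pAMl.
Qed.

(** Since [w] is outside [P], it is invertible modulo each power of [P], and there [t] generates
    [P]. *)
Lemma prime_uniformizer : exists2 t, t \in (P : {pred A}) &
  exists2 w, w \notin (P : {pred A}) &
    forall x, x \in (P : {pred A}) -> exists y, w * x = t * y.
Proof.
have [b pb bP] := prime_socle.
have [t Pt Nt] : exists2 t, t \in (P : {pred A}) &
    ~ exists2 y, y \in (P : {pred A}) & t * b = p%:R * y.
  apply: contrapT => NP; case/negP: pb.
  (* If [g P <= P], then, starting from [p] in [P], every [p g ^ i] is in [P]; so [g] is integral
     and [b = p g] is in [p A]. *)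
  have stable x : x \in (P : {pred A}) ->
      exists2 y, y \in (P : {pred A}) & x * b = p%:R * y.
    by move=> Px; apply: contrapT => Nx; apply: NP; exists x.
  have p_neq0 : p%:R != 0 :> K by rewrite ext_natr_eq0 -lt0n prime_gt0.
  pose g : K := \val b / p%:R.
  have bE : \val b = p%:R * g by rewrite mulrC mulfVK.
  have /ri_lift[y yg] : integralOver (intr : int -> K) g.
    apply: (almost_integral p_pr) => i.
    suff [y _ yE] : exists2 y : A, y \in (P : {pred A}) &
        \val y = p%:R * g ^+ i.
      by exists y.
    elim: i => [|i [y Py yE]].
      by exists p%:R; rewrite ?prime_natr_in // rmorph_nat mulr1.
    have [z Pz /(congr1 val)] := stable y Py.
    rewrite !rmorphM rmorph_nat /= => yz; exists z => //.
    by apply: (mulfI p_neq0); rewrite -yz yE bE exprSr; ring.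
  by apply/pAP; exists y; apply: val_inj; rewrite rmorphM rmorph_nat /= yg -bE.
have /pAP[w tb] := bP t Pt.
exists t => //; exists w; first by apply/negP => Pw; apply: Nt; exists w.
(* From [t b = p w] and [x b = p y] follows [p w x = p t y]. *)
move=> x /bP/pAP[y xb]; exists y; apply: (ri_natr_mulI p_pr).
by rewrite mulrA -tb mulrAC -mulrA [in RHS]mulrCA -xb; ring.
Qed.

End PrimeIdeal.

(** * Quotients by prime powers *)

Lemma quot_eqP (R : comNzRingType) (I : idealr R) (x y : R) :
  (\pi_{ideal_quot I} x = \pi_{ideal_quot I} y) <-> x - y \in (I : {pred R}).
Proof. by rewrite Quotient.idealrBE; split=> [->|/eqP]. Qed.

Lemma quot_eq0 (R : comNzRingType) (I : idealr R) (x : R) :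
  (\pi_{ideal_quot I} x = 0) <-> x \in (I : {pred R}).
Proof. by rewrite -(rmorph0 \pi_{ideal_quot I}) quot_eqP subr0. Qed.

Section IdealPowerQuotient.
Variables (R : comNzRingType) (P : prime_idealr R).
Variables (k : nat) (k_gt0 : (0 < k)%N).
Local Notation T := {ideal_quot (idealXp P k_gt0)}.
Local Notation F := {ideal_quot P}.

Lemma idealX_exp n x y : x \in (P : {pred R}) ->
  x ^+ n * y \in idealX (P : {pred R}) n.
Proof.
move=> Px; elim: n => [//|n IHn]; apply/asboolP.
exists 1%N, (fun=> x), (fun=> x ^+ n * y); split=> //.
by rewrite big_ord1 exprS mulrA.
Qed.

Lemma idealX_sub n x : (0 < n)%N ->
  x \in idealX (P : {pred R}) n -> x \in (P : {pred R}).
Proof.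
case: n => // n _ /asboolP[m [u [v [Pu _ ->]]]].
by apply: rpred_sum => i _; rewrite mulrC idealMr.
Qed.

(** The choice of representative is harmless, as [P ^ k <= P] for positive [k]. *)
Definition power_quot_proj (a : T) : F := \pi_F (repr a).

Lemma power_quot_projE x : power_quot_proj (\pi_T x) = \pi_F x.
Proof.
apply/quot_eqP/(idealX_sub k_gt0).
by apply: (iffLR (@quot_eqP _ (idealXp P k_gt0) _ _)); rewrite reprK.
Qed.

Lemma power_quot_proj_zmod : zmod_morphism power_quot_proj.
Proof.
move=> a b; rewrite -[a]reprK -[b]reprK -rmorphB.
by rewrite !power_quot_projE rmorphB.
Qed.

Lemma power_quot_proj_monoid : monoid_morphism power_quot_proj.
Proof.
split=> [|a b]; first by rewrite -(rmorph1 \pi_T) power_quot_projE rmorph1.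
rewrite -[a]reprK -[b]reprK -rmorphM.
by rewrite !power_quot_projE rmorphM.
Qed.

HB.instance Definition _ :=
  GRing.isZmodMorphism.Build T F power_quot_proj power_quot_proj_zmod.
HB.instance Definition _ :=
  GRing.isMonoidMorphism.Build T F power_quot_proj power_quot_proj_monoid.

Lemma power_quot_proj_surj y : exists x, power_quot_proj x = y.
Proof. by exists (\pi_T (repr y)); rewrite power_quot_projE reprK. Qed.

Variable t : R.
Hypothesis Pt : t \in (P : {pred R}).
Hypothesis t_gen : forall x, x \in (P : {pred R}) ->
  exists y, x - t * y \in idealX (P : {pred R}) k.

Lemma power_quot_uniformizer_nil : \pi_T t ^+ k = 0.
Proof.
rewrite -rmorphXn; apply/quot_eq0.
by rewrite -[_ ^+ _]mulr1; apply: idealX_exp.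
Qed.

Lemma power_quot_prime x : x \in (P : {pred R}) ->
  exists y, \pi_T x = \pi_T t * y.
Proof.
move=> /t_gen[y xy]; exists (\pi_T y); rewrite -rmorphM.
exact/quot_eqP.
Qed.

Lemma power_quot_proj_ker a :
  power_quot_proj a = 0 <-> exists y, a = \pi_T t * y.
Proof.
split=> [/quot_eq0/power_quot_prime|[y ->]]; first by rewrite reprK.
by rewrite rmorphM /= power_quot_projE (iffRL (quot_eq0 _ _) Pt) mul0r.
Qed.

Lemma ideal_image_prime a : a \in ideal_image P (idealXp P k_gt0) <->
  exists y, a = \pi_T t * y.
Proof.
split=> [/asboolP[x Px ->]|[y ->]]; first exact: power_quot_prime.
apply/asboolP; exists (t * repr y); first by rewrite mulrC idealMr.
by rewrite rmorphM /= reprK.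
Qed.

Lemma ideal_image_prime2 a :
  a \in ideal_image (idealX (P : {pred R}) 2) (idealXp P k_gt0) <->
  exists y, a = \pi_T t ^+ 2 * y.
Proof.
split=> [/asboolP[_ /asboolP[n [u [v [Pu Pv ->]]]] ->]|[y ->]]; last first.
  apply/asboolP; exists (t ^+ 2 * repr y); first exact: idealX_exp.
  by rewrite rmorphM rmorphXn /= reprK.
rewrite rmorph_sum; apply: (big_ind (fun z => exists y, z = \pi_T t ^+ 2 * y)).
- by exists 0; rewrite mulr0.
- by move=> _ _ [y1 ->] [y2 ->]; exists (y1 + y2); rewrite mulrDr.
move=> l _; have [y1 uE] := power_quot_prime (Pu l).
(* [idealX P 1] is by definition the product of [P] with the whole ring, so [v l] is first put into
   [P]. *)
have [y2 vE] := power_quot_prime (idealX_sub (isT : (0 < 1)%N) (Pv l)).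
by exists (y1 * y2); rewrite rmorphM /= uE vE; ring.
Qed.

End IdealPowerQuotient.

(** * Residue fields, uniformizers and residual degrees *)

Section PrimeQuotient.
Variables (K : fieldExtType rat) (p : nat).
Hypothesis p_pr : prime p.
Local Notation A := (ring_of_integers K).
Variable P : prime_idealr A.
Hypothesis P_p : lies_over P p.

Lemma prime_quot_field (x : {ideal_quot P}) : x != 0 -> exists y, x * y = 1.
Proof.
rewrite -[x]reprK => x0.
have /(prime_maximal p_pr P_p)[z xz] : repr x \notin (P : {pred A}).
  by apply: contra_neqN x0 => /quot_eq0.
exists (\pi_{ideal_quot P} z); rewrite -rmorphM -(rmorph1 \pi_{ideal_quot P}).
exact/esym/quot_eqP.
Qed.

(** With [1 - w z] in [P], the element [(1 - w z) ^ k] of [P ^ k] has the form [1 - w v]; so [v]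
    inverts [w] modulo [P ^ k] and [w x = t y] becomes [x = t y v] there. *)
Lemma prime_power_uniformizer : exists2 t, t \in (P : {pred A}) &
  forall k x, x \in (P : {pred A}) ->
    exists y, x - t * y \in idealX (P : {pred A}) k.
Proof.
have [t Pt [w /(prime_maximal p_pr P_p)[z Pwz] wP]] :=
  prime_uniformizer p_pr P_p.
exists t => // k x /wP[y wxy].
have [v vE] : exists v, w * v = 1 - (1 - w * z) ^+ k.
  exists (z * \sum_(i < k) (1 - w * z) ^+ i).
  have := subrXX 1 (1 - w * z) k; rewrite expr1n => ->.
  rewrite mulrA opprB addrCA subrr addr0; congr (_ * _).
  by apply: eq_bigr => i _; rewrite expr1n mul1r.
exists (y * v).
have -> : x - t * (y * v) = (1 - w * z) ^+ k * x.
  have -> : (1 - w * z) ^+ k = 1 - w * v by rewrite vE; ring.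
  by rewrite mulrA -wxy; ring.
exact: idealX_exp.
Qed.

(** A basis modulo [D = 0] of the whole of [A / P], with the integer coefficients then reduced
    modulo [p]. *)
Lemma residual_degree_exists : exists f, residual_degree P p f.
Proof.
pose Q := {ideal_quot P}.
have zero_closed : zmod_closed (pred1 0 : {pred Q}).
  by split=> [|x y /eqP-> /eqP->]; rewrite inE ?subrr.
pose Z : zmodClosed Q := HB.pack (pred1 0 : {pred Q})
  (GRing.isZmodClosed.Build Q (pred1 0 : {pred Q}) zero_closed).
have [x|x|f [b [_ bfree bgen]]] :=
    @exists_basis_mod Q p (\dim {:K}).+1 predT Z p_pr.
- rewrite -[x]reprK -mulr_natl -(rmorph_nat \pi_Q) -rmorphM inE; apply/eqP.
  by apply/quot_eq0; rewrite mulrC idealMr // prime_natr_in.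
- have [c ci cx] := ri_relation p_pr (fun i => repr (x i)).
  exists c => //; rewrite inE; apply/eqP.
  have := congr1 \pi_Q cx; rewrite rmorph0 rmorph_sum => cQ.
  rewrite -[RHS]cQ; apply: eq_bigr => i _.
  by rewrite rmorphMz /= reprK.
have p_zero (y : Q) z : (p %| z)%Z -> y *~ z = 0.
  move=> /dvdzP[e ->]; rewrite mulrzA -pmulrn -mulr_natl.
  suff -> : p%:R = 0 :> Q by rewrite mul0r.
  by rewrite -(rmorph_nat \pi_Q); apply/quot_eq0/prime_natr_in.
exists f, (fun i => b i) => x; have [c] := bgen x isT.
rewrite inE subr_eq0 => /eqP xc.
have natFp (e : 'F_p) : (e : nat)%:R = e by apply: natr_Zp.
exists [ffun l : 'I_f => (c l)%:~R]; split=> [|c' xc'].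
  rewrite xc; apply: eq_bigr => l _; rewrite ffunE mulr_natl pmulrn.
  apply/eqP; rewrite -subr_eq0 -mulrzBr; apply/eqP/p_zero.
  by rewrite (dvdz_pcharf (pchar_Fp p_pr)) rmorphB /= -pmulrn natFp subrr.
apply/ffunP => l; rewrite ffunE; apply/eqP.
rewrite -subr_eq0 -[c' l]natFp pmulrn -rmorphB /=.
rewrite -(dvdz_pcharf (pchar_Fp p_pr)).
(* The second family is extended by 0 past [f], since [bfree] takes functions on [nat]. *)
pose d i := c i - oapp (fun l => (c' l : nat)%:Z) 0 (insub i).
have -> : c l - (c' l : nat)%:Z = d l by rewrite /d valK.
apply: bfree => //; rewrite inE; apply/eqP.
rewrite -[RHS](subrr x) {1}xc xc' -sumrB; apply: eq_bigr => j _.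
by rewrite /d valK /= mulrzBr mulr_natl pmulrn.
Qed.

End PrimeQuotient.

Lemma residual_degree_isom (R : comNzRingType) (P Q : prime_idealr R) p f
    (sigma : {rmorphism {ideal_quot P} -> {ideal_quot Q}}) :
  bijective sigma -> residual_degree P p f -> residual_degree Q p f.
Proof.
move=> [tau sK tK] [b bP]; exists (sigma \o b) => y.
have sumE (c : {ffun 'I_f -> 'F_p}) :
    \sum_l (c l : nat)%:R * (sigma \o b) l =
    sigma (\sum_l (c l : nat)%:R * b l).
  by rewrite rmorph_sum; apply: eq_bigr => l _; rewrite rmorphM rmorph_nat.
have [c [xc cU]] := bP (tau y); exists c; split=> [|c'].
  by rewrite sumE -xc tK.
by rewrite sumE => yc'; apply: cU; rewrite yc' sK.
Qed.

(** * Maximal subrings of a product of quotients by prime powers *)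

Theorem theorem23 (K : fieldExtType rat) (p s : nat)
    (P : 'I_s -> prime_idealr (ring_of_integers K)) (k : 'I_s -> nat)
    (p_prime : prime p)
    (P_distinct : forall i j : 'I_s, i != j -> ~ (P i =i P j))
    (P_over_p : forall i, lies_over (P i) p)
    (k_gt0 : forall i, (0 < k i)%N)
    (M : {pred ring_product
                 (fun i : 'I_s => {ideal_quot (idealXp (P i) (k_gt0 i))})})
    (M_max : maximal_subring M) :
  (exists i (Mi : {pred {ideal_quot (idealXp (P i) (k_gt0 i))}}),
     ordinary Mi /\ forall a, (a \in M) = (a i \in Mi))
  \/
  (exists i (Mi : {pred {ideal_quot (idealXp (P i) (k_gt0 i))}}),
     exceptional Mi /\ forall a, (a \in M) = (a i \in Mi))
  \/
  (exists i j : 'I_s,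
     [/\ (i < j)%N,
         exists f, residual_degree (P i) p f /\ residual_degree (P j) p f
       & exists2 sigma : {rmorphism {ideal_quot (P i)} -> {ideal_quot (P j)}},
           bijective sigma &
           forall a, a \in M <->
             exists x : 'I_s -> ring_of_integers K,
               (forall l, a l = \pi_{ideal_quot (idealXp (P l) (k_gt0 l))} (x l)) /\
               \pi_{ideal_quot (P j)} (x j)
                 = sigma (\pi_{ideal_quot (P i)} (x i))]).
Proof.
have t_ex i : exists t, t \in (P i : {pred _}) /\ forall k x,
    x \in (P i : {pred _}) -> exists y, x - t * y \in idealX (P i) k.
  by have [t Pt tP] := prime_power_uniformizer p_prime (P_over_p i); exists t.
have [t tP] := choice t_ex.
have Pt i : t i \in (P i : {pred _}) by case: (tP i).
have t_gen i x : x \in (P i : {pred _}) ->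
    exists y, x - t i * y \in idealX (P i) (k i).
  by case: (tP i) => _; apply.
have [] := @maximal_subring_product s _ M M_max (fun i => {ideal_quot P i})
  (fun i => @power_quot_proj _ (P i) (k i) (k_gt0 i))
  (fun i => \pi_{ideal_quot (idealXp (P i) (k_gt0 i))} (t i)) k.
- by move=> i; apply: (power_quot_uniformizer_nil _ (Pt i)).
- by move=> i; apply: power_quot_proj_surj.
- by move=> i x; apply: (power_quot_proj_ker (Pt i) (t_gen i)).
- by move=> i x; apply: (prime_quot_field p_prime (P_over_p i)).
(* The conductors generated by [t] and [t ^ 2] are the images of [P] and [P ^ 2]. *)
- move=> [i [Mi [Mi_max MiE [CMi|CMi]]]]; [left|right; left]; exists i, Mi;
    split=> //; split=> // x; apply/idP/idP.
  + by move=> /CMi/(ideal_image_prime (Pt i) (t_gen i)).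
  + by move=> /(ideal_image_prime (Pt i) (t_gen i))/CMi.
  + by move=> /CMi/(ideal_image_prime2 (Pt i) (t_gen i)).
  + by move=> /(ideal_image_prime2 (Pt i) (t_gen i))/CMi.
move=> [i [j [ij [sigma sigma_bij ME]]]]; right; right; exists i, j; split=> //.
  have [f Pif] := residual_degree_exists p_prime (P_over_p i).
  by exists f; split=> //; apply: residual_degree_isom sigma_bij Pif.
exists sigma => // a; split=> [/ME aE|[x [ax xE]]].
  (* The projection is defined through [repr], so [aE] is the required equation by conversion. *)
  exists (fun l => repr (a l)); split=> [l|]; first by rewrite reprK.
  exact: aE.
by apply/ME; rewrite !ax /= !power_quot_projE.
Qed.
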